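(* Let $X$ be a regular $T_1$ topological space. The following statements are equivalent. (1) $(\mathcal{K}(X),\tau_V)$ is a $D_1$-space. (2) $(\mathcal{F}_n(X),\tau_V)$ is a $D_1$-space for some $n\geq 2$. (3) $X$ is discrete or $X$ is compact metrizable.
   Context: $CL(X)$ is the set of all nonempty closed subsets of $X$; $\mathcal{K}(X)$ is the set of all nonempty compact subsets of $X$; $\mathcal{F}_n(X)=\{A\subset X: A\neq\emptyset, |A|\leq n\}$. The Vietoris topology $\tau_V$ on $CL(X)$ is generated by the sets $\langle U_1,\ldots,U_k\rangle=\{H\in CL(X): H\subset\bigcup_{i=1}^k U_i,\ H\cap U_j\neq\emptyset \text{ for } 1\leq j\leq k\}$, where $k\in\mathbb{N}$ and $U_1,\ldots,U_k$ are open in $X$. On $\mathcal{K}(X)$ and $\mathcal{F}_n(X)$, $\tau_V$ denotes the subspace topology. A space $Y$ is a $D_1$-space if every closed subset $A$ of $Y$ has a countable local base, i.e. there is a countable family of open sets containing $A$ such that every open set containing $A$ contains a member of the family. *)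

(* Defs.v *)
From HB Require Import structures.
From mathcomp Require Import all_boot all_order all_algebra.
From mathcomp Require Import all_classical all_reals topology.

Set Implicit Arguments.
Unset Strict Implicit.
Unset Printing Implicit Defensive.

Local Open Scope classical_set_scope.

Record CL (X : topologicalType) : Type := MkCL {
  CL_set :> set X;
  CL_nonempty : CL_set !=set0;
  CL_closed : closed CL_set
}.

HB.instance Definition _ (X : topologicalType) := gen_eqMixin (CL X).
HB.instance Definition _ (X : topologicalType) := gen_choiceMixin (CL X).

Definition vietoris (X : topologicalType) (k : nat) (U : 'I_k -> set X) :
    set (CL X) :=
  [set H : CL X | H `<=` \bigcup_i U i /\ forall j, H `&` U j !=set0].

Definition vietoris_generators (X : topologicalType) : set (set (CL X)) :=
  [set W | exists k (U : 'I_k -> set X),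
    [/\ (0 < k)%N, forall i, open (U i) & W = vietoris U]].

HB.instance Definition _ (X : topologicalType) :=
  isSubBaseTopological.Build (CL X) (@vietoris_generators X) id.

(* In a T1 (resp. Hausdorff) space finite (resp. compact) sets are closed, so
   carving these hyperspaces out of [CL X] loses nothing for regular T1 [X].
   Viewed as types they carry the library's subspace topology on [set_type]. *)
Definition compact_hyperspace (X : topologicalType) : set (CL X) :=
  [set H : CL X | compact H].

Definition finite_hyperspace (X : topologicalType) (n : nat) : set (CL X) :=
  [set H : CL X | (H #<= `I_n)%card].

Definition D1_space (Y : topologicalType) : Prop :=
  forall A : set Y, closed A ->
    exists B : set (set Y),
      [/\ countable B,
          forall U, B U -> open U /\ A `<=` U
        & forall V, open V -> A `<=` V -> exists2 U, B U & U `<=` V].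

Definition discrete_space (X : topologicalType) : Prop :=
  forall A : set X, open A.

Definition metrizable (R : realType) (X : topologicalType) : Prop :=
  exists (M : metricType R) (f : X -> M) (g : M -> X),
    [/\ cancel f g, cancel g f, continuous f & continuous g].

(* Main.v *)
Require Import Defs.
From HB Require Import structures.
From mathcomp Require Import all_boot all_order all_algebra finmap.
From mathcomp Require Import all_classical all_reals topology.

(** Let [P] be either hyperspace.  It contains every pair [{a, b}], and
    [(a, b) |-> {a, b}] is continuous; this is all that the passage from (1)
    or (2) to (3) uses ([D1_hyperspace_compact_metrizable]).

    Suppose that [P] is D1 and that [x0] is not isolated in [X].  If a sequence
    [d] had no cluster point, then, after a shift which keeps it away from
    [x0], the pairs [{x0, d k}] would form a closed set.  Given a sequence [U]
    of open sets around it, [U k] contains a pair [{x k, d k}] with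
    [x k <> x0], and the closed set has an open neighbourhood that avoids all
    the pairs [{x k, d k}], so it contains no [U k].  Hence every sequence in
    [X] has a cluster point ([D1_nondiscrete_countably_compact]).

    The singletons form a closed set as well, [X] being Hausdorff; a countable base at this set
    pulls back, along [(a, b) |-> {a, b}], to a countable base at the diagonal
    of [X * X].  When [X] is regular T1 and every sequence has a cluster point,
    the neighbourhoods of the diagonal form a uniformity
    ([diagonal_nbhs_split]), here with a countable base: [X] is metrizable,
    hence also compact ([diagonal_base_compact_metrizable]).

    For the converse, if [X] is discrete then all the sets in the hyperspaces
    concerned are finite and are isolated points.  If [X] is compact and
    metrizable then [CL X] is compact ([compact_CL]) and second countable
    ([CL_countable_base]), and the set of all [{a, b}] is compact as the image
    of [X * X]; a compact subspace of a second countable space is D1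
    ([countable_base_compact_D1]), since the finite unions of basic open sets
    that contain a compact set form a base at it. *)

Set Implicit Arguments.
Unset Strict Implicit.
Unset Printing Implicit Defensive.

Import Order.TTheory GRing.Theory Num.Theory.

Local Open Scope classical_set_scope.

(** * The Vietoris topology *)

Section vietoris_topology.
Context {X : topologicalType}.
Implicit Types (H K L : CL X) (U : set X).

Lemma CL_eq H K : H = K :> set X -> H = K.
Proof.
case: H K => [A A0 Ac] [B B0 Bc] /= AB; subst B.
by rewrite (Prop_irrelevance A0 B0) (Prop_irrelevance Ac Bc).
Qed.

Lemma open_vietoris k (U : 'I_k -> set X) : (0 < k)%N ->
  (forall i, open (U i)) -> open (vietoris U).
Proof.
move=> k0 oU; exists [set (vietoris U)]; last by rewrite bigcup_set1.
move=> _ ->; exists [fset (vietoris U)]%fset.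
  by move=> W /fset1P ->; apply/mem_set; exists k, U.
by rewrite set_fset1 bigcap_set1.
Qed.

Lemma open_CL_sub U : open U -> open [set H : CL X | H `<=` U].
Proof.
move=> oU; rewrite (_ : mkset _ = vietoris (fun _ : 'I_1 => U)).
  exact: open_vietoris.
apply/seteqP; split=> H /=.
  move=> HU; split; first by move=> x Hx; exists ord0 => //; apply: HU.
  by have [x Hx] := CL_nonempty H; exists x; split => //; apply: HU.
by move=> [HU _] x /HU [].
Qed.

Lemma open_CL_meets U : open U -> open [set H : CL X | H `&` U !=set0].
Proof.
move=> oU.
rewrite (_ : mkset _ =
  vietoris (fun i : 'I_2 => if i == ord0 then setT else U)).
  by apply: open_vietoris => // i; case: ifP => _ //; exact: openT.
apply/seteqP; split=> H /=.
  move=> HU; split; first by move=> x Hx; exists ord0.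
  move=> j; case: ifP => _ //.
  by have [x Hx] := CL_nonempty H; exists x.
by move=> [_ /(_ ord_max)].
Qed.

(** The sets [{H | H `<=` U}] and [{H | H meets U}], [U] open, form a subbase of
    the Vietoris topology, so convergence may be tested on them. *)
Lemma cvg_CL (F : set_system (CL X)) (L : CL X) : Filter F ->
  (forall U, open U -> L `<=` U -> F [set H : CL X | H `<=` U]) ->
  (forall U, open U -> L `&` U !=set0 -> F [set H : CL X | H `&` U !=set0]) ->
  F --> L.
Proof.
move=> FF Fsub Fmeets W; rewrite nbhsE => -[O [[D DI <-] [V DV LV]] OW].
apply: filterS OW _; apply: (@filterS _ _ _ V); first by move=> H VH; exists V.
have [E ED VE] := DI _ DV; rewrite -VE; apply: filter_bigI => G GE.
have /set_mem [k [U [k0 oU GU]]] := ED _ GE; rewrite GU.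
have [LU LUj] : vietoris U L by rewrite -GU; move: LV; rewrite -VE; apply.
apply: filterI; first by apply: Fsub => //; apply: bigcup_open.
by apply: filter_forall => j; exact: Fmeets.
Qed.

Lemma closed_set2 : accessible_space X -> forall a b : X, closed [set a; b].
Proof.
move=> T1 a b.
exact: (accessible_finite_set_closed.1 T1 _ (finite_set2 a b)).
Qed.

Lemma set2_nonempty (a b : X) : [set a; b] !=set0.
Proof. by exists a; left. Qed.

(** The point [{a, b}] of the hyperspace, a singleton when [a = b]. *)
Definition pair_CL (T1 : accessible_space X) (ab : X * X) : CL X :=
  MkCL (set2_nonempty ab.1 ab.2) (@closed_set2 T1 ab.1 ab.2).

Lemma pair_CL_continuous (T1 : accessible_space X) : continuous (pair_CL T1).
Proof.
move=> [a b]; apply: cvg_CL => U oU /=.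
  move=> abU; exists (U, U) => /=.
    by split; apply: open_nbhs_nbhs; split => //; apply: abU; [left|right].
  by move=> [x y] [/= Ux Uy] z [] ->.
move=> [x [[->|->] Ux]].
  exists (U, setT) => /=.
    by split; [exact: open_nbhs_nbhs|exact: filterT].
  by move=> [y z] [/= Uy _]; exists y; split => //; left.
exists (setT, U) => /=.
  by split; [exact: filterT|exact: open_nbhs_nbhs].
by move=> [y z] [/= _ Uz]; exists z; split => //; right.
Qed.
End vietoris_topology.

(** * Countable compactness *)

(** Countable compactness, in the form: every sequence has a cluster point. *)
Definition countably_compact (X : topologicalType) :=
  forall u : nat -> X, cluster (u @ \oo) !=set0.

Lemma cluster_seq (X : topologicalType) (u : nat -> X) y M N :
  cluster (u @ \oo) y -> nbhs y M -> exists2 n, (N <= n)%N & M (u n).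
Proof.
move=> uy yM; have uN : (u @ \oo) (u @` [set n | (N <= n)%N]).
  by exists N => // n Nn; exists n.
by have [_ [[n Nn <-] Mun]] := uy _ _ uN yM; exists n.
Qed.

Lemma not_cluster_seq (X : topologicalType) (u : nat -> X) y :
  ~ cluster (u @ \oo) y ->
  exists M N, [/\ open M, M y & forall n, (N <= n)%N -> ~ M (u n)].
Proof.
move=> /existsNP[A] /existsNP[M] /not_implyP[[N _ NA]] /not_implyP[yM].
move=> /nonemptyPn AM; exists M°, N; split=> [|//|n Nn /interior_subset Mn].
  exact: open_interior.
have : (A `&` M) (u n) by split => //; exact: NA.
by rewrite AM.
Qed.

Lemma closed_locally_finite_range (X : topologicalType) (d : nat -> X)
    (I : set nat) :
  accessible_space X -> ~ (cluster (d @ \oo) !=set0) -> closed (d @` I).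
Proof.
move=> T1 dN; rewrite -openC openE => y ny.
have [M [N [oM My NM]]] : exists M N,
    [/\ open M, M y & forall n, (N <= n)%N -> ~ M (d n)].
  by apply: not_cluster_seq => dy; apply: dN; exists y.
(* only finitely many terms lie in M, and finite sets are closed *)
have cI : closed (d @` [set n | (n < N)%N /\ I n]).
  apply: (accessible_finite_set_closed.1 T1); apply: finite_image.
  by apply: (@sub_finite_set _ _ `I_N) => // n [].
have : nbhs y (M `&` ~` (d @` [set n | (n < N)%N /\ I n])).
  apply: filterI; apply: open_nbhs_nbhs; split => //; first exact: closed_openC.
  by move=> [n [_ In] ny']; apply: ny; exists n.
apply: filterS => z [Mz nz] [n In nzE]; apply: nz; exists n => //; split => //.
by rewrite ltnNge; apply/negP => /NM; rewrite nzE.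
Qed.

Section uniform_countably_compact.
Context {U : uniformType}.
Hypothesis ccU : countably_compact U.

(** Otherwise a greedy choice gives a sequence with no term [E]-close to an
    earlier one, which cannot cluster. *)
Lemma countably_compact_totally_bounded (E : set (U * U)) : entourage E ->
  exists s : {fset U}, forall x, exists2 z, z \in s & E (z, x).
Proof.
move=> entE; apply: contrapT => noS.
have /choice[f fP] : forall s : {fset U}, exists x,
    forall z, z \in s -> ~ E (z, x).
  move=> s; apply: contrapT => sE; apply: noS; exists s => x.
  apply: contrapT => sx; apply: sE; exists x => z zs Ezx.
  by apply: sx; exists z.
(* l n is the set of the first n points chosen *)
pose l := fix l n := if n is n'.+1 then (f (l n') |` l n')%fset else fset0.
have lP m n : (m < n)%N -> f (l m) \in l n.
  elim: n => // n IH; rewrite ltnS leq_eqVlt => /orP[/eqP ->|/IH mn].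
    exact: fset1U1.
  exact: fset1Ur.
have [y yP] := ccU (f \o l).
have Eyy : nbhs y (xsection (split_ent E `&` (split_ent E)^-1%relation) y).
  by apply: nbhs_entourage; apply: entourage_invI; exact: entourage_split_ent.
have [m _ /xsectionP[_ ym]] := cluster_seq 0 yP Eyy.
have [n mn /xsectionP[yn _]] := cluster_seq m.+1 yP Eyy.
by apply: (fP (l n) (f (l m))); [exact: lP|exact: (entourage_split y)].
Qed.

(** Given a base [G] of entourages, an ultrafilter contains for each [n] the
    section of [G 0 `&` ... `&` G n] at some point [c n], by total boundedness;
    it converges to every cluster point of [c]. *)
Lemma countably_compact_compact :
  countable_uniformity U -> compact [set: U].
Proof.
move=> /countable_uniformityP[G Gsub entG]; rewrite compact_ultra => F FU _.
have /choice[c Fc] : forall n, exists x, F (xsection (\bigcap_(i < n.+1) G i) x).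
  move=> n; have entGn : entourage (\bigcap_(i < n.+1) G i).
    rewrite (_ : bigcap _ _ = [set p | forall i : 'I_n.+1, G i p]).
      by apply: filter_forall => i; exact: entG.
    apply/seteqP; split=> [p Gp i|p Gp i /= ilt]; first by apply: Gp => /=.
    exact: (Gp (Ordinal ilt)).
  have [s sP] := countably_compact_totally_bounded entGn.
  apply: contrapT => noc.
  have [x] : (\bigcap_(z in [set` s])
      ~` xsection (\bigcap_(i < n.+1) G i) z) !=set0.
    apply: (@filter_ex _ F); apply: filter_bigI => z zs.
    have [Fz|//] := in_ultra_setVsetC (xsection (\bigcap_(i < n.+1) G i) z) FU.
    by case: noc; exists z.
  by have [z zs Gzx] := sP x; move=> /(_ z zs); apply; apply/xsectionP.
have [y yc] := ccU c; exists y; split=> //.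
apply/cvg_entourageP => E entE.
have [k kE] := Gsub _ (entourage_split_ent entE).
have [n kn /xsectionP yn] :=
  cluster_seq k yc (nbhs_entourage y (entourage_split_ent entE)).
apply: filterS (Fc n) => x /xsectionP Gx.
apply: (entourage_split (c n)) => //; apply: kE.
by apply: Gx; rewrite /= ltnS.
Qed.
End uniform_countably_compact.

(** * Metrization *)

Section pseudometric_metrizable.
Context {R : realType} {M : pseudoMetricType R}.
Hypothesis hM : hausdorff_space M.
Local Open Scope ring_scope.

Let D (x y : M) : set R := [set e | 0 < e /\ (ball x e y \/ 1 <= e)].
(** The infimum of the radii [e] with [ball x e y], truncated at 1: the radii
    at least 1 are always counted, so that the infimum is over a nonempty
    set. *)
Definition truncated_dist x y : R := inf (D x y).

Let D_inf x y : has_inf (D x y).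
Proof.
by split; [exists 1; split => //; right|exists 0 => e [/ltW]].
Qed.

Lemma truncated_dist_le x y e : 0 < e -> ball x e y -> truncated_dist x y <= e.
Proof. by move=> e0 xy; apply: ge_inf; [case: (D_inf x y)|split=> //; left]. Qed.

Lemma truncated_dist_ball x y e : truncated_dist x y < e -> e <= 1 -> ball x e y.
Proof.
move=> de e1; have [f [f0 [xy|f1]] fe] := inf_lt (D_inf x y).1 de.
  exact: le_ball (ltW fe) _ xy.
by move: (lt_le_trans fe e1); rewrite ltNge f1.
Qed.

Lemma truncated_dist_ge0 x y : 0 <= truncated_dist x y.
Proof. by apply: lb_le_inf; [case: (D_inf x y)|move=> e [/ltW]]. Qed.

Lemma truncated_dist_xx x : truncated_dist x x = 0.
Proof.
apply/eqP; rewrite eq_le truncated_dist_ge0 andbT.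
apply/ler_addgt0Pl => e e0; rewrite addr0.
by apply: truncated_dist_le => //; exact: ballxx.
Qed.

Lemma truncated_dist_pos x y : truncated_dist x y = 0 -> x = y.
Proof.
move=> d0; apply: hM => A B /nbhs_ballP[e /= e0 eA] /nbhs_singleton By.
exists y; split => //; apply: eA.
have [e1|e1] := leP e 1; first by apply: truncated_dist_ball => //; rewrite d0.
by apply: le_ball (ltW e1) _ _; apply: truncated_dist_ball; rewrite ?d0.
Qed.

Lemma truncated_dist_sym x y : truncated_dist x y = truncated_dist y x.
Proof.
by congr inf; apply/seteqP; split=> e [e0 [/ball_sym|]] => [|e1||e1];
  split=> //; [left|right|left|right].
Qed.

Lemma truncated_dist_triangle y x z :
  truncated_dist x z <= truncated_dist x y + truncated_dist y z.
Proof.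
apply/ler_addgt0Pr => e e0.
have e20 : 0 < e / 2 by rewrite divr_gt0.
have [a [a0 aP] ax] : exists2 a, D x y a & a < truncated_dist x y + e / 2.
  by apply: (inf_lt (D_inf x y).1); rewrite ltrDl.
have [b [b0 bP] bx] : exists2 b, D y z b & b < truncated_dist y z + e / 2.
  by apply: (inf_lt (D_inf y z).1); rewrite ltrDl.
apply: (@le_trans _ _ (a + b)); last first.
  by rewrite [e]splitr addrACA; apply: lerD; [exact: ltW ax|exact: ltW bx].
apply: ge_inf; first by case: (D_inf x z).
split; first exact: addr_gt0.
case: aP bP => [xy [yz|b1]|a1 _].
- by left; exact: ball_triangle xy yz.
- by right; rewrite (le_trans b1)// lerDr ltW.
- by right; rewrite (le_trans a1)// lerDl ltW.
Qed.

(** A copy of [M] to carry the metric [truncated_dist]. *)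
Definition truncated & hausdorff_space M : Type := M.
HB.instance Definition _ := Choice.on (truncated hM).
HB.instance Definition _ := isMetric.Build R (truncated hM)
  truncated_dist_xx truncated_dist_pos truncated_dist_sym truncated_dist_triangle.

Lemma pseudometric_metrizable : metrizable R M.
Proof.
exists (truncated hM), (id : M -> truncated hM), id; split => // x A.
  move=> /nbhs_ballP[e /= e0]; rewrite ballEmdist => eA; apply/nbhs_ballP.
  exists (e / 2); first by rewrite /= divr_gt0.
  move=> y xy; apply: eA => /=; apply: (@le_lt_trans _ _ (e / 2)).
    by apply: truncated_dist_le => //; rewrite divr_gt0.
  by rewrite ltr_pdivrMr// ltr_pMr// ltr1n.
move=> /nbhs_ballP[e /= e0 eA]; apply/nbhs_ballP.
exists (Num.min e 1); first by rewrite /= lt_min e0 /=.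
move=> y; rewrite ballEmdist/= => xy; apply: eA.
have m1 : Num.min e 1 <= 1 by rewrite ge_min lexx orbT.
have := truncated_dist_ball xy m1.
by apply: le_ball; rewrite ge_min lexx.
Qed.
End pseudometric_metrizable.

(** The neighbourhoods of the diagonal of [X * X]. *)
Definition diagonal_nbhs (X : topologicalType) : set_system (X * X) :=
  [set E | forall x : X, nbhs (x, x) E].

Section diagonal_uniformity.
Context {X : topologicalType}.
Hypothesis X_regular : regular_space X.
Hypothesis X_T1 : accessible_space X.
Hypothesis ccX : countably_compact X.
Variable G : nat -> set (X * X).
Hypothesis Gnbhs : forall n, diagonal_nbhs (G n).
Hypothesis Gbase : forall E, diagonal_nbhs E -> exists n, G n `<=` E.

Lemma nbhs_square (x : X) E : nbhs (x, x) E ->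
  exists N, [/\ open N, N x & forall y z, N y -> N z -> E (y, z)].
Proof.
move=> [[P Q] /= [xP xQ] PQE].
have : nbhs x (P `&` Q) by exact: filterI.
rewrite nbhsE => -[N [oN Nx] NPQ]; exists N; split=> // y z /NPQ[Py _] /NPQ[_ Qz].
exact: PQE.
Qed.

Lemma regular_hausdorff : hausdorff_space X.
Proof.
move=> x y xy; apply: contrapT => /eqP; rewrite eq_sym => yx.
have [W [oW /set_mem Wy /set_mem nWx]] := X_T1 yx.
have /X_regular[V yV VW] : nbhs y W by exact: open_nbhs_nbhs.
apply: nWx; apply: VW => B xB.
by have [z [Bz Vz]] := xy _ _ xB yV; exists z.
Qed.

(** [M] is a neighbourhood of [y] with closure inside [N]; two points related by
    the neighbourhood of the diagonal are both in [N] as soon as one of them is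
    in [M]. *)
Lemma regular_separating_nbhs (y : X) N : open N -> N y ->
  exists2 M, nbhs y M &
    diagonal_nbhs [set p | N p.1 /\ N p.2 \/ ~ M p.1 /\ ~ M p.2].
Proof.
move=> oN Ny; have /X_regular[M yM MN] : nbhs y N by exact: open_nbhs_nbhs.
exists M => // x; have [Nx|nNx] := pselect (N x).
  exists (N, N) => /=; first by split; exact: open_nbhs_nbhs.
  by move=> [a b] [/= ? ?]; left.
have oC : open (~` closure M) by apply: closed_openC; exact: closed_closure.
exists (~` closure M, ~` closure M) => /=.
  by split; apply: open_nbhs_nbhs; split => //; apply: contra_not nNx => /MN.
by move=> [a b] [/= Ma Mb]; right; split; [apply: contra_not Ma|
  apply: contra_not Mb]; exact: subset_closure.
Qed.

Lemma diagonal_nbhs_filter : Filter (@diagonal_nbhs X).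
Proof.
split; first by move=> x; exact: filterT.
  by move=> A B dA dB x; apply: filterI; [exact: dA|exact: dB].
by move=> A B AB dA x; apply: filterS AB _; exact: dA.
Qed.

Lemma diagonal_nbhs_diagonal E : @diagonal_nbhs X E -> diagonal `<=` E.
Proof. by move=> dE [x y] /diagonalP ->; exact: nbhs_singleton (dE y). Qed.

Lemma diagonal_nbhs_inv E : @diagonal_nbhs X E -> diagonal_nbhs (E^-1)%relation.
Proof.
move=> dE x; have [[P Q] /= [xP xQ] PQE] := dE x.
by exists (Q, P) => // -[a b] [/= Qa Pb]; exact: PQE.
Qed.

(** Were there none, the triples [(x, y, z)] with [x], [y] and [y], [z] close to
    order [n] but [(x, z)] outside [E] would have their middle points cluster
    at some [y]; near [y] the other two points are forced into a square inside
    [E]. *)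
Lemma diagonal_nbhs_split E : @diagonal_nbhs X E ->
  exists2 B, diagonal_nbhs B & (B \; B `<=` E)%relation.
Proof.
move=> dE; apply: contrapT => noB.
have FF := diagonal_nbhs_filter.
pose G' n := [set p | forall i : 'I_n.+1, G i p].
have dG' n : diagonal_nbhs (G' n).
  move=> x; apply: (@filter_forall _ 'I_n.+1 (fun i => G i) (nbhs (x, x))) => i.
  exact: Gnbhs.
have /choice[p pP] : forall n, exists p : X * X * X,
    [/\ G' n (p.1.1, p.1.2), G' n (p.1.2, p.2) & ~ E (p.1.1, p.2)].
  move=> n; apply: contrapT => np; apply: noB; exists (G' n) => //.
  move=> [x z] [y /= xy yz]; apply: contrapT => nE.
  by apply: np; exists (x, y, z).
have [y yP] := ccX (fun n => (p n).1.2).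
have [N [oN Ny NE]] := nbhs_square (dE y).
have [M yM dO] := regular_separating_nbhs oN Ny.
have [k kO] := Gbase dO.
have [n kn Mn] := cluster_seq k yP yM.
have [xy yz] := pP n; apply.
have G'G q : G' n q -> G k q by move=> /(_ (Ordinal (kn : k < n.+1)%N)).
apply: NE.
  by have /kO[[]|[_]] := G'G _ xy.
by have /kO[[]|[]] := G'G _ yz.
Qed.

Lemma diagonal_nbhsE : nbhs = nbhs_ (@diagonal_nbhs X).
Proof.
apply/funext => x; apply/seteqP; split=> A.
  rewrite nbhsE => -[N [oN Nx] NA].
  have [M xM dO] := regular_separating_nbhs oN Nx.
  exists [set p | N p.1 /\ N p.2 \/ ~ M p.1 /\ ~ M p.2] => //.
  move=> y /xsectionP[[_ /NA]//|[/=]].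
  by have := nbhs_singleton xM.
move=> [E dE EA]; have [[P Q] /= [xP xQ] PQE] := dE x.
apply: filterS xQ => y Qy; apply: EA; apply/xsectionP; apply: PQE.
by split => //=; exact: nbhs_singleton.
Qed.

Lemma diagonal_base_compact_metrizable (R : realType) :
  compact [set: X] /\ metrizable R X.
Proof.
(* this uniformity keeps the topology of X, so that the facts about X apply to
   U and to M as they are *)
pose U : uniformType := HB.pack (Topological.sort X)
  (Nbhs_isUniform_mixin.Build (Topological.sort X)
    diagonal_nbhs_filter diagonal_nbhs_diagonal diagonal_nbhs_inv
    diagonal_nbhs_split diagonal_nbhsE).
have cU : countable_uniformity U.
  by apply/countable_uniformityP; exists G.
have ccU : countably_compact U by exact: ccX.
split; first exact: (countably_compact_compact ccU cU).
pose M : pseudoMetricType R := countable_uniform.type cU.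
have hU : hausdorff_space M by exact: regular_hausdorff.
exact: (pseudometric_metrizable hU).
Qed.
End diagonal_uniformity.

(** * From the D1 property to compact metrizability *)

(** A countable base at the trace on [P] of a closed set [C] of [Y], by open sets
    of [Y]. *)
Lemma D1_subspace_base (Y : topologicalType) (P C : set Y) :
  D1_space (set_type P) -> closed C ->
  exists U : nat -> set Y, [/\ forall n, open (U n),
    forall n, C `&` P `<=` U n &
    forall V, open V -> C `&` P `<=` V -> exists n, U n `&` P `<=` V].
Proof.
move=> D1 cC.
have cA : closed (set_val @^-1` C : set (set_type P)).
  apply: preimage_closed => //.
  by move=> x _; exact: (@initial_continuous (set_type P) Y set_val).
have [B [cB BA Bmin]] := D1 _ cA.
have [W0 BW0 _] := Bmin setT openT (@subsetT _ _).
have [f fB] : exists f : nat -> set (set_type P), B = range f.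
  have /pfcard_geP[B0|/unsquash g] := cB; first by rewrite B0 in BW0.
  by exists g; apply/esym; exact: surj_image_eq.
have /choice[U UP] : forall n, exists U : set Y,
    open U /\ set_val @^-1` U = f n.
  move=> n; have /BA[[U oU Uf] _] : B (f n) by rewrite fB; exists n.
  by exists U.
exists U; split=> [n|n|V oV CV].
- by have [] := UP n.
- move=> y [Cy Py]; have [_ fU] := UP n.
  have /BA[_ /(_ (SigSub (mem_set Py)) Cy)] : B (f n).
    by rewrite fB; exists n.
  by rewrite -fU.
- have [||W] := Bmin (set_val @^-1` V).
  + by exists V.
  + move=> y Cy; apply: CV; split => //; exact: set_valP.
  + rewrite fB => -[n _ <-] fnV; exists n => y [Uy Py].
    have [_ fU] := UP n.
    by have := fnV (SigSub (mem_set Py)); rewrite -fU; apply.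
Qed.

Section D1_hyperspace.
Context {X : topologicalType}.

(** The pairs [{x0, d k}] form a closed set when [d] is locally finite and avoids
    [x0]: a set [H] that is not one of them either misses [x0], or has a point
    outside [{x0}] and the range [D] of [d], or misses [D], or contains two
    distinct terms of [d], and each of these is stable in a neighbourhood of
    [H] that contains no such pair. *)
Lemma closed_pairs (T1 : accessible_space X) (x0 : X) (d : nat -> X) :
  (forall I, closed (d @` I)) -> ~ range d x0 ->
  closed [set H | exists k, H = pair_CL T1 (x0, d k)].
Proof.
move=> cd nDx0; set C := (X in closed X); pose D := range d.
suff nbhsC (H : CL X) : ~ C H -> nbhs H (~` C).
  by rewrite -openC openE => H; exact: nbhsC.
move=> nH.
have [Hx0|Hx0] := pselect (CL_set H x0); last first.
  have : nbhs H [set K : CL X | K `<=` ~` [set x0]].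
    apply: open_nbhs_nbhs; split; last by move=> z Hz zx; apply: Hx0; rewrite -zx.
    by apply: open_CL_sub; apply: closed_openC; exact: accessible_closed_set1.
  apply: filterS => K Kx0 [k KE]; apply: (Kx0 x0) => //.
  by rewrite KE; left.
have oE j : open (~` ([set x0] `|` d @` [set i | d i <> d j])).
  by apply: closed_openC; apply: closedU => //; exact: accessible_closed_set1.
have [[h [Hh hD]]|HD] := pselect (exists h, CL_set H h /\ ~ ([set x0] `|` D) h).
  have : nbhs H [set K : CL X | K `&` ~` ([set x0] `|` D) !=set0].
    apply: open_nbhs_nbhs; split; last by exists h.
    apply: open_CL_meets; apply: closed_openC; apply: closedU => //.
      exact: accessible_closed_set1.
    exact: cd.
  apply: filterS => K [z [Kz zD]] [k KE]; apply: zD.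
  by move: Kz; rewrite KE => -[->|->]; [left|right; exists k].
have [[i Hi]|Hd] := pselect (exists i, CL_set H (d i)); last first.
  have : nbhs H [set K : CL X | K `<=` ~` D].
    apply: open_nbhs_nbhs; split; last first.
      by move=> z Hz [i _ iz]; apply: Hd; exists i; rewrite iz.
    by apply: open_CL_sub; apply: closed_openC; exact: cd.
  apply: filterS => K KD [k KE]; apply: (KD (d k)); last by exists k.
  by rewrite KE; right.
have [j [Hj ji]] : exists j, CL_set H (d j) /\ d j <> d i.
  apply: contrapT => nj; apply: nH; exists i; apply: CL_eq; apply/seteqP.
  split=> [z Hz|z [->|->]//].
  have [[->|[j _ jz]]|zD] := pselect (([set x0] `|` D) z).
  - by left.
  - right => /=; apply: contrapT => zi; apply: nj; exists j; rewrite jz.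
    by split.
  - by case: HD; exists z.
pose E k := [set K : CL X |
  K `&` ~` ([set x0] `|` d @` [set i | d i <> d k]) !=set0].
have oEk k : open (E k) by exact: open_CL_meets.
have EH k : CL_set H (d k) -> E k H.
  move=> Hk; exists (d k); split => //; case=> [dx|[l /= lk kl]] //.
  by apply: nDx0; exists k.
have : nbhs H (E i `&` E j).
  by apply: open_nbhs_nbhs; split; [exact: openI|split; exact: EH].
apply: filterS => K [[z [Kz zi]] [w [Kw wj]]] [k KE].
apply: ji; apply: (@eq_trans _ _ (d k)).
  apply: contrapT => jk; apply: wj; move: Kw; rewrite KE => -[->|->]; [by left|].
  by right; exists k => //= kj; apply: jk.
apply: contrapT => ki; apply: zi; move: Kz; rewrite KE => -[->|->]; [by left|].
by right; exists k.
Qed.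

Hypothesis X_T1 : accessible_space X.
Variable P : set (CL X).
Hypothesis P_pair : forall ab, P (pair_CL X_T1 ab).
Hypothesis P_D1 : D1_space (set_type P).

(** If [x0] is not isolated and [d] has no cluster point, no sequence of open
    sets is a base at the closed set of the pairs [{x0, d k}]. *)
Lemma D1_nondiscrete_countably_compact (x0 : X) : ~ open [set x0] ->
  countably_compact X.
Proof.
move=> nx0 e; apply: contrapT => eN.
have [M [N [oM Mx0 NM]]] : exists M N,
    [/\ open M, M x0 & forall n, (N <= n)%N -> ~ M (e n)].
  by apply: not_cluster_seq => ex; apply: eN; exists x0.
(* the shifted sequence avoids M *)
pose d n := e (N + n)%N.
have dM n : ~ M (d n) by apply: NM; rewrite leq_addr.
have dN : ~ (cluster (d @ \oo) !=set0).
  move=> [y dy]; apply: eN; exists y => B V [k _ kB] yV.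
  have [n kn Vn] := cluster_seq k dy yV; exists (d n); split => //.
  by apply: kB => /=; rewrite (leq_trans kn)// leq_addl.
have cd I : closed (d @` I) by exact: closed_locally_finite_range.
have nDx0 : ~ range d x0 by move=> [n _ dn]; apply: (dM n); rewrite dn.
have cC := closed_pairs (T1 := X_T1) cd nDx0.
have [U [oU CU UV]] := D1_subspace_base P_D1 cC.
have /choice[x xP] : forall k, exists x,
    x <> x0 /\ U k (pair_CL X_T1 (x, d k)).
  move=> k; apply: contrapT => nx; apply: nx0; rewrite openE => _ ->.
  have Uk : nbhs (pair_CL X_T1 (x0, d k)) (U k).
    apply: open_nbhs_nbhs; split => //; apply: CU; split; last exact: P_pair.
    by exists k.
  have [[Q S] /= [xQ dS] QS] := pair_CL_continuous Uk.
  apply: filterS xQ => y Qy /=; apply: contrapT => yx; apply: nx.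
  exists y; split => //; apply: (QS (y, d k)); split => //=.
  exact: nbhs_singleton dS.
(* W k is a neighbourhood of x0 that contains no term of d and no x j with
   d j = d k, and there are finitely many such j *)
pose W k := M `\` x @` [set j | d j = d k].
have oW k : open (W k).
  apply: openI => //.
  apply: closed_openC; apply: (accessible_finite_set_closed.1 X_T1).
  apply: finite_image; have [V [m [_ Vk mV]]] : exists V m,
      [/\ open V, V (d k) & forall n, (m <= n)%N -> ~ V (d n)].
    by apply: not_cluster_seq => dk; apply: dN; exists (d k).
  apply: (@sub_finite_set _ _ `I_m) => // j /= jk.
  by rewrite ltnNge; apply/negP => /mV; rewrite jk.
have Wd j k : ~ W k (d j) by move=> [/dM].
(* d k is the only term of d in O k *)
pose O k := ~` (d @` [set i | d i <> d k]).
have oO k : open (O k) by exact: closed_openC.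
(* by the choice of W and O this neighbourhood of the pairs {x0, d k} contains
   no pair {x j, d j} *)
have [k] : exists k, U k `&` P `<=` \bigcup_k
    ([set H : CL X | H `<=` W k `|` O k] `&`
     [set H : CL X | H `&` W k !=set0]).
  apply: UV.
    apply: bigcup_open => k _; apply: openI.
      by apply: open_CL_sub; exact: openU.
    exact: open_CL_meets.
  move=> _ [[k ->] _]; exists k => //.
  have Wx0 : W k x0.
    by split => //; move=> [j /= _ jx]; have [] := xP j.
  split; last by exists x0; split => //; left.
  by move=> z [->|->]; [left|right => -[i /= ik]].
move=> /(_ (pair_CL X_T1 (x k, d k))) [|j _ [sub [z [zk Wz]]]].
  by split; [case: (xP k)|exact: P_pair].
have dkj : d k = d j.
  have [/Wd//|Ok] := sub (d k) (or_intror erefl).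
  by apply: contrapT => kj; apply: Ok; exists k.
case: zk Wz => -> /=; last exact: Wd.
by case=> _; apply; exists k.
Qed.

(** A base at the set of singletons pulls back to a base at the diagonal: for a
    neighbourhood [E] of the diagonal, the sets [H] contained in some open [N]
    with [N * N] inside [E] form a neighbourhood of the singletons. *)
Lemma D1_hyperspace_compact_metrizable (R : realType) : regular_space X ->
  discrete_space X \/ compact [set: X] /\ metrizable R X.
Proof.
move=> X_regular.
have [d|/existsNP[x0 nx0]] := pselect (forall x : X, open [set x]).
  left=> A; rewrite (_ : A = \bigcup_(x in A) [set x]).
    exact: bigcup_open.
  by apply/seteqP; split=> [x Ax|x [y Ay ->]]; first by exists x.
right.
have ccX := D1_nondiscrete_countably_compact nx0.
have hX := regular_hausdorff X_regular X_T1.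
(* the set of singletons *)
pose C := [set H : CL X | is_subset1 H].
have cC : closed C.
  suff nbhsC (H : CL X) : ~ C H -> nbhs H (~` C).
    by rewrite -openC openE => H; exact: nbhsC.
  move=> /existsNP[a] /existsNP[b] /not_implyP[Ha] /not_implyP[Hb].
  move=> /eqP ab; move: hX; rewrite open_hausdorff => /(_ _ _ ab).
  move=> [[A B] /= [/set_mem Aa /set_mem Bb] [oA oB /eqP AB]].
  have : nbhs H ([set K : CL X | K `&` A !=set0] `&`
                 [set K : CL X | K `&` B !=set0]).
    apply: open_nbhs_nbhs; split; first by apply: openI; exact: open_CL_meets.
    by split; [exists a|exists b].
  apply: filterS => K [[y [Ky Ay]] [z [Kz Bz]]] K1.
  have : (A `&` B) y by split => //; rewrite (K1 _ _ Ky Kz).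
  by rewrite AB.
have [U [oU CU UV]] := D1_subspace_base P_D1 cC.
apply: (@diagonal_base_compact_metrizable _ X_regular X_T1 ccX
  (fun n => pair_CL X_T1 @^-1` U n)).
  move=> n x; apply: pair_CL_continuous; apply: open_nbhs_nbhs; split => //.
  by apply: CU; split; [move=> y z [->|->] [->|->]|exact: P_pair].
move=> E dE.
have [n nE] : exists n, U n `&` P `<=`
    \bigcup_(N in [set N : set X | open N /\
                     forall y z, N y -> N z -> E (y, z)])
      [set H : CL X | H `<=` N].
  apply: UV; first by apply: bigcup_open => N [oN _]; exact: open_CL_sub.
  move=> H [H1 _]; have [x Hx] := CL_nonempty H.
  have [N [oN Nx NE]] := nbhs_square (dE x).
  by exists N => // y Hy; rewrite (H1 _ _ Hy Hx).
exists n => -[x y] Uxy; have [//|N [_ NE] sN] := nE (pair_CL X_T1 (x, y)).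
by apply: NE; apply: sN; [left|right].
Qed.
End D1_hyperspace.

(** * Compactness and countable bases of hyperspaces *)

(** Compactness gives finite subcovers, also when [T] has no chosen point. *)
Lemma compact_cover_compact (T : topologicalType) (A : set T) :
  compact A -> cover_compact A.
Proof.
move=> cA I D f fo Af; apply: contrapT => nfin.
pose F := filter_from [set s : {fset I} | {subset s <= D}]
  (fun s => A `\` cover [set` s] f).
have FF : ProperFilter F.
  apply: filter_from_proper; last first.
    move=> s sD; apply: contrapT => /nonemptyPn.
    by rewrite setD_eq0 => As; apply: nfin; exists s.
  apply: filter_from_filter; first by exists fset0 => // i; rewrite inE.
  move=> s t sD tD; exists (s `|` t)%fset; first by move=> i /fsetUP[/sD|/tD].
  move=> x [Ax nx]; split; split=> // -[i si fi]; apply: nx; exists i => //;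
    apply/fsetUP; by [left|right].
have FA : F A by exists fset0 => [i|x []//]; rewrite inE.
have [x [Ax Fx]] := cA F FF FA.
have [i Di fix_] := Af x Ax.
have Fi : F (A `\` f i).
  exists [fset i]%fset; first by move=> j /fset1P ->; exact: mem_set.
  by move=> y [Ay ny]; split=> // fiy; apply: ny; exists i => //=; rewrite inE.
by have [y [[_ nfi]]] := Fx _ _ Fi (open_nbhs_nbhs (conj (fo i Di) fix_)).
Qed.

(** [b] enumerates a base of the topology. *)
Definition countable_base (Y : topologicalType) (b : nat -> set Y) :=
  (forall n, open (b n)) /\
  (forall y V, nbhs y V -> exists2 n, b n y & b n `<=` V).

Lemma second_countable_base (Y : topologicalType) : @second_countable Y ->
  exists b : nat -> set Y, countable_base b.
Proof.
move=> [B cB [oB Bbase]].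
have /pfcard_geP[B0|/unsquash g] := cB.
  exists (fun=> set0); split=> [n|y V]; first exact: open0.
  by move=> /Bbase[U []]; rewrite B0.
have [h hB] : exists h : nat -> set Y, range h = B.
  by exists g; exact: surj_image_eq.
exists h; split=> [n|y V /Bbase[U [BU Uy] UV]].
  by apply: oB; rewrite -hB; exists n.
by move: BU; rewrite -hB => -[n _ hU]; exists n; rewrite hU.
Qed.

Lemma compact_finite_base_cover (Y : topologicalType) (b : nat -> set Y)
    (K V : set Y) : countable_base b -> compact K -> open V -> K `<=` V ->
  exists s : seq nat, K `<=` \bigcup_(i in [set` s]) b i /\
    \bigcup_(i in [set` s]) b i `<=` V.
Proof.
move=> [ob bbase] /compact_cover_compact cK oV KV.
have [||s sV Ks] := cK nat [set n | b n `<=` V] b.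
  by move=> n _; exact: ob.
  move=> y Ky; have Vy : nbhs y V by apply: open_nbhs_nbhs; split=> //; exact: KV.
  by have [n bny bnV] := bbase y V Vy; exists n.
by exists s; split=> // y [n /sV/set_mem]; apply.
Qed.

Lemma countable_base_compact_D1 (Y : topologicalType) (b : nat -> set Y)
  (P : set Y) : countable_base b -> compact P -> D1_space (set_type P).
Proof.
move=> bb cP A; rewrite -openC => -[C oC CA].
pose W (s : seq nat) := \bigcup_(i in [set` s]) b i.
exists [set set_val @^-1` (W s) |
  s in [set s | A `<=` (set_val @^-1` (W s) : set (set_type P))]]; split.
- by apply: card_le_trans (card_image_le _ _) _; exact: countableP.
- move=> _ [s AW <-]; split=> //; exists (W s) => //.
  by apply: bigcup_open => i _; exact: bb.1.
- move=> _ [V oV <-] AV.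
  have [||s [s1 s2]] := compact_finite_base_cover (K := P `&` ~` C) bb _ oV.
  + by apply: compact_closedI => //; exact: open_closedC.
  + move=> y [Py Cy]; apply: (AV (SigSub (mem_set Py))).
    apply: contrapT => nA; apply: Cy.
    by move: nA; rewrite -[~ A _]/((~` A) _) -CA.
  + exists (set_val @^-1` W s) => //; last by move=> y /= /s2.
    exists s => // y Ay; apply: s1; split; first exact: set_valP.
    move=> Cy; have : (set_val @^-1` C) y by [].
    by rewrite CA; apply.
Qed.

Lemma open_forall_seq (Y : topologicalType) (I : eqType) (s : seq I)
    (Q : I -> set Y) :
  (forall i, open (Q i)) -> open [set y | forall i, i \in s -> Q i y].
Proof.
move=> oQ; elim: s => [|j s IH].
  rewrite (_ : mkset _ = setT); [exact: openT|].
  by apply/seteqP; split.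
rewrite (_ : mkset _ = Q j `&` [set y | forall i, i \in s -> Q i y]).
  exact: openI.
apply/seteqP; split=> [y Qy|y [Qjy Qy] i].
  split; first by apply: Qy; rewrite mem_head.
  by move=> i si; apply: Qy; rewrite in_cons si orbT.
by rewrite in_cons => /orP[/eqP -> //|/Qy].
Qed.

Section compact_CL.
Context {X : topologicalType}.
Hypothesis cX : compact [set: X].

Lemma compact_closed_set (H : set X) : closed H -> compact H.
Proof. by move=> cH; apply: (subclosed_compact cH cX). Qed.

(** An ultrafilter on [CL X] converges to the set [L] of the points all of whose
    neighbourhoods are met by almost every set, in the sense of the
    ultrafilter. *)
Lemma compact_CL : compact [set: CL X].
Proof.
rewrite compact_ultra => F FU _.
pose L := [set x | forall U, open U -> U x -> F [set H : CL X | H `&` U !=set0]].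
(* almost every set misses a given closed set disjoint from L *)
have missL C : closed C -> C `<=` ~` L -> F [set H : CL X | H `<=` ~` C].
  move=> cC CnL; have /compact_cover_compact cover := compact_closed_set cC.
  pose D := [set U : set X | open U /\ ~ F [set H : CL X | H `&` U !=set0]].
  have [U []//|x /CnL /existsNP[U]
    /not_implyP[oU] /not_implyP[Ux nF]|s sD Cs] := cover _ D id.
    by exists U.
  have : F (\bigcap_(U in [set` s]) ~` [set H : CL X | H `&` U !=set0]).
    apply: filter_bigI => U /sD/set_mem[_ nF].
    by have [] := in_ultra_setVsetC [set H : CL X | H `&` U !=set0] FU.
  apply: filterS => H HU x Hx /Cs[U Us Ux]; apply: (HU U Us).
  by exists x.
have cL : closed L.
  rewrite -openC openE => x /existsNP[U] /not_implyP[oU] /not_implyP[Ux nF].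
  rewrite /interior nbhsE; exists U => // y Uy /(_ U oU Uy); exact: nF.
have L0 : L !=set0.
  apply: contrapT => L0.
  have [H HT] : [set H : CL X | H `<=` ~` setT] !=set0.
    by apply: (@filter_ex _ F); apply: missL => // x _ Lx; apply: L0; exists x.
  by have [x Hx] := CL_nonempty H; exact: (HT x Hx).
exists (MkCL L0 cL); split => //; apply: cvg_CL => U oU /=.
  move=> LU; rewrite -[U]setCK; apply: missL; first exact: open_closedC.
  by move=> x nU /LU.
by move=> [x [Lx Ux]]; exact: Lx.
Qed.

(** The base consists of the finite intersections of sets [{H | H `<=` W}], with
    [W] a finite union of basic open sets, and [{H | H meets b i}]; compactness
    of the points of [CL X] makes finite unions sufficient. *)
Lemma CL_countable_base (b : nat -> set X) : countable_base b ->
  exists c : nat -> set (CL X), countable_base c.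
Proof.
move=> bb; pose W (s : seq nat) := \bigcup_(i in [set` s]) b i.
have oW s : open (W s) by apply: bigcup_open => i _; exact: bb.1.
pose N (p : seq (seq nat) * seq nat) : set (CL X) :=
  [set H | forall s, s \in p.1 -> H `<=` W s] `&`
  [set H | forall i, i \in p.2 -> H `&` b i !=set0].
have oN p : open (N p).
  apply: openI.
    apply: (@open_forall_seq _ _ _ (fun s => [set H : CL X | H `<=` W s])) => s.
    exact: open_CL_sub.
  apply: (@open_forall_seq _ _ _
    (fun i => [set H : CL X | H `&` b i !=set0])) => i.
  by apply: open_CL_meets; exact: bb.1.
exists (fun n => oapp N set0 (choice.unpickle n)); split.
  by move=> n; case: (choice.unpickle n) => [p|]; [exact: oN|exact: open0].
move=> H V HV.
suff : filter_from [set p | N p H] N --> H.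
  by move=> /(_ _ HV)[p NpH NpV]; exists (choice.pickle p); rewrite choice.pickleK.
apply: cvg_CL.
- apply: filter_from_filter; first by exists ([::], [::]).
  move=> [s t] [s' t'] [/= Hs Ht] [/= Hs' Ht']; exists (s ++ s', t ++ t').
    split=> /= i; rewrite mem_cat => /orP[];
      by [exact: Hs|exact: Hs'|exact: Ht|exact: Ht'].
  by move=> K [/= Ks Kt]; split; split=> /= i si;
    [apply: Ks|apply: Kt|apply: Ks|apply: Kt]; rewrite mem_cat si ?orbT.
- move=> U oU HU.
  have cH := compact_closed_set (@CL_closed _ H).
  have [s [Hs sU]] := compact_finite_base_cover bb cH oU HU.
  exists ([:: s], [::]); first by split=> // s'; rewrite inE => /eqP ->.
  move=> K [/= /(_ s) Ks _]; apply: (subset_trans (Ks _)) => //.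
  by rewrite inE.
- move=> U oU [x [Hx Ux]].
  have [n bnx bnU] := bb.2 x U (open_nbhs_nbhs (conj oU Ux)).
  exists ([::], [:: n]).
    by split=> // i; rewrite inE => /eqP ->; exists x.
  move=> K [_ /(_ n)]/=; rewrite inE eqxx => /(_ isT)[y [Ky bny]].
  by exists y; split=> //; exact: bnU.
Qed.

Lemma compact_metrizable_countable_base (R : realType) : metrizable R X ->
  exists b : nat -> set X, countable_base b.
Proof.
move=> [M [f [g [fK gK cf cg]]]].
have [[x _]|X0] := pselect (exists x : X, True); last first.
  exists (fun=> set0); split=> [n|y]; first exact: open0.
  by case: X0; exists y.
pose pM : pseudoPMetricType R :=
  HB.pack (Metric.sort M) (isPointed.Build (Metric.sort M) (f x)).
have cM : compact [set: pM].
  rewrite (_ : [set: pM] = f @` [set: X]); last first.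
    by apply/seteqP; split=> // y _; exists (g y) => //; exact: gK.
  by apply: continuous_compact => //; exact: continuous_subspaceT.
have [b [ob bb]] := second_countable_base (compact_second_countable cM).
exists (fun n => f @^-1` b n); split=> [n|y V yV].
  by apply: open_comp => // z _; exact: cf.
have [n bn bnV] : exists2 n, b n (f y) & b n `<=` g @^-1` V.
  by apply: bb; apply: cg; rewrite fK.
by exists n => // z /bnV /=; rewrite fK.
Qed.
End compact_CL.

(** * Discrete spaces and sets with at most two points *)

(** Finite sets are isolated points of [CL X], so every subset of [P] is open and
    is a base at itself. *)
Lemma discrete_finite_D1 (X : topologicalType) (P : set (CL X)) :
  discrete_space X -> (forall H, P H -> finite_set H) -> D1_space (set_type P).
Proof.
move=> dX Pfin A _.
have oA B : open (B : set (set_type P)).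
  exists (\bigcup_(H in set_val @` B) [set H]); last first.
    apply/seteqP; split=> [H [_ [K BK <-] HK]|H BH].
      by rewrite (_ : H = K) //; apply: val_inj.
    by exists (set_val H) => //; exists H.
  apply: bigcup_open => _ [[H PH] _ <-].
  have /finite_seqP[s Hs] := Pfin _ (set_mem PH).
  rewrite (_ : [set _] = [set K : CL X | K `<=` H] `&`
    [set K : CL X | forall x, x \in s -> K `&` [set x] !=set0]).
    apply: openI; first exact: open_CL_sub.
    apply: (@open_forall_seq _ _ _
      (fun x => [set K : CL X | K `&` [set x] !=set0])) => x.
    exact: open_CL_meets.
  apply/seteqP; split=> [K ->|K [KH sK]].
    split=> // x xs; exists x; split => //.
    by have : [set` s] x by []; rewrite -Hs.
  apply: CL_eq; apply/seteqP; split=> // x /=; rewrite Hs => /= xs.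
  by have [y [Ky <-]] := sK x xs.
exists [set A]; split=> [|U ->|V oV AV]; first exact: countable1.
  by split=> //; exact: oA.
by exists A.
Qed.

Lemma discrete_compact_finite (X : topologicalType) (K : set X) :
  discrete_space X -> compact K -> finite_set K.
Proof.
move=> dX /compact_cover_compact/(_ X K (fun x => [set x]))[||s _ Ks].
- by move=> x _; exact: dX.
- by move=> x Kx; exists x.
- apply: (@sub_finite_set _ _ [set` s]); last exact: finite_fset.
  by move=> x /Ks[y ys ->].
Qed.

Lemma card_set2 (T : Type) (a b : T) (n : nat) :
  (2 <= n)%N -> ([set a; b] #<= `I_n)%card.
Proof.
move=> n2; have -> : [set a; b] = (fun i => if i == 0%N then a else b) @` `I_2.
  apply/seteqP; split=> [x [->|->]|x [[|i] _ <-]];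
    by [exists 0|exists 1|left|right].
apply: card_le_trans (card_image_le _ _) _; apply: subset_card_le => i /= i2.
exact: leq_trans i2 n2.
Qed.

Lemma card_le2_set2 (T : Type) (A : set T) : A !=set0 -> (A #<= `I_2)%card ->
  exists a b, A = [set a; b].
Proof.
move=> [a Aa] /pcard_leP/unsquash f.
have [[b [Ab ba]]|nb] := pselect (exists b, A b /\ b <> a); last first.
  exists a, a; apply/seteqP; split=> [x Ax|x [->|->]//].
  by left; apply: contrapT => xa; apply: nb; exists x.
exists a, b; apply/seteqP; split=> [x Ax|x [->|->]//].
apply: contrapT => /not_orP[xa xb].
have fI y z : A y -> A z -> f y = f z -> y = z.
  by move=> Ay Az; apply: (@inj _ _ _ f); exact: mem_set.
(* three distinct points cannot be injected into {0, 1} *)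
have [fa fb fx] : [/\ (f a < 2)%N, (f b < 2)%N & (f x < 2)%N].
  by split; exact: (@funS _ _ _ _ f).
have Nab : f a <> f b by move=> /fI E; apply: ba; rewrite E.
have Nax : f a <> f x by move=> /fI E; apply: xa; rewrite E.
have Nbx : f b <> f x by move=> /fI E; apply: xb; rewrite E.
by move: (f a) (f b) (f x) fa fb fx Nab Nax Nbx => [|[|?]] [|[|?]] [|[|?]].
Qed.

(** * The equivalence *)

Lemma D1_compact_hyperspace (R : realType) (X : topologicalType) :
  discrete_space X \/ compact [set: X] /\ metrizable R X ->
  D1_space (set_type (@compact_hyperspace X)).
Proof.
move=> [dX|[cX mX]].
  by apply: discrete_finite_D1 => // H; exact: discrete_compact_finite.
have [b bb] := compact_metrizable_countable_base cX mX.
have [c cc] := CL_countable_base cX bb.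
apply: (countable_base_compact_D1 cc).
rewrite (_ : @compact_hyperspace X = setT); first exact: compact_CL.
by apply/seteqP; split=> // H _; apply: compact_closed_set => //; exact: CL_closed.
Qed.

Lemma D1_finite_hyperspace2 (R : realType) (X : topologicalType) :
  accessible_space X ->
  discrete_space X \/ compact [set: X] /\ metrizable R X ->
  D1_space (set_type (@finite_hyperspace X 2)).
Proof.
move=> T1 [dX|[cX mX]].
  apply: discrete_finite_D1 => // H H2; exact: card_le_finite H2 (finite_II 2).
have [b bb] := compact_metrizable_countable_base cX mX.
have [c cc] := CL_countable_base cX bb.
apply: (countable_base_compact_D1 cc).
rewrite (_ : @finite_hyperspace X 2 = range (pair_CL T1)).
  apply: continuous_compact; last by rewrite -setXTT; exact: compact_setX.
  by apply: continuous_subspaceT; exact: pair_CL_continuous.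
apply/seteqP; split=> [H H2|_ [ab _ <-]]; last exact: card_set2.
have [x [y Hxy]] := card_le2_set2 (CL_nonempty H) H2.
by exists (x, y) => //; exact: CL_eq.
Qed.

Theorem theorem2p8 (R : realType) (X : topologicalType)
    (X_regular : @regular_space X) (X_T1 : @accessible_space X) :
  [<-> D1_space (set_type (@compact_hyperspace X));
       exists2 n : nat, (2 <= n)%N & D1_space (set_type (@finite_hyperspace X n));
       discrete_space X \/ (compact [set: X] /\ metrizable R X)].
Proof.
tfae.
- move=> D1; exists 2 => //; apply: (D1_finite_hyperspace2 (R := R) X_T1).
  apply: (D1_hyperspace_compact_metrizable (X_T1 := X_T1) _ D1) => // ab.
  by apply: finite_compact; exact: finite_set2.
- move=> [n n2 D1].
  apply: (D1_hyperspace_compact_metrizable (X_T1 := X_T1) _ D1) => // ab.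
  exact: card_set2.
- exact: D1_compact_hyperspace.
Qed.
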